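(* (i) There is an absolute constant $C>0$ such that the following holds. Let $p$ be a prime, $R\subseteq \mathbb{F}_p^*$ a multiplicative subgroup and $l\ge 4$ an integer. If $|R| \ge C \min\{ p^{\frac{2l+2}{5l-3}}, p^{\frac{l+5}{3l+3}} \}$, then $\mathbb{F}^*_p \subseteq lR$. (ii) Let $p$ be a prime, $R\subseteq \mathbb{F}_p^*$ a multiplicative subgroup and $l\ge 2$ an integer. If $|R|>p^{\frac{l+1}{2l}}$, then $\mathbb{F}^*_p \subseteq lR$.
   Context: $lR=\{r_1+\dots+r_l : r_i\in R\}$ denotes the $l$-fold sumset of $R$. *)

(* Defs.v *)
From mathcomp Require Import all_boot all_order all_algebra.
From Stdlib Require Import Reals.
Set Implicit Arguments. Unset Strict Implicit. Unset Printing Implicit Defensive.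
Import GRing.Theory.

Definition mult_subgroup (p : nat) (R : {set 'F_p}) : Prop :=
  [/\ (GRing.zero : 'F_p) \notin R, (GRing.one _ : 'F_p) \in R,
      (forall x y, x \in R -> y \in R -> GRing.mul x y \in R)
    & (forall x, x \in R -> GRing.inv x \in R)].

Fixpoint sumset (p : nat) (l : nat) (R : {set 'F_p}) : {set 'F_p} :=
  match l with
  | 0 => [set (GRing.zero : 'F_p)]
  | l'.+1 => [set GRing.add x y | x in sumset l' R, y in R]
  end.

(* Main.v *)
Require Import Defs.
From mathcomp Require Import all_boot all_order all_algebra all_field zify ring lra.

(** Write t = |R|, S(a) = sum over r in R of psi(a r) for a nontrivial additive character psi of F_p,
    r(v) = #{(r, s) in R x R : r - s = v} and E = sum of r(v)^2.  If a nonzero x is not in lR, then no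
    element of xR is, and orthogonality of characters gives
    t^(l+1) <= sum over a <> 0 of |S(a)|^l |S(a x)|.
    Since |S| is constant on the cosets of R, the moments sum |S|^2 = p t and sum |S|^4 = p E give
    |S(a)|^2 <= p and t |S(a)|^4 <= p E for a <> 0, while t |S(a)|^2 = sum r(v) S(a v)
    and two applications of Cauchy-Schwarz give |S(a)|^8 <= p E^2.  The first bound yields (ii); the
    two others yield (i) as soon as E^2 <= K t^5.
    This last estimate (Heath-Brown and Konyagin) comes from Stepanov's method.  If H is the set of the
    x^-t with r(x) >= tau, then there are at least |H| tau points u with u^t = (u-1)^t in H.  A nonzero
    combination of the X^a X^(t b) (X-1)^(t c) vanishing to high order at all these points bounds
    their number, whence |H| tau^3 = O(t^2) for tau >= sqrt t, and summing over tau bounds E.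
    The degrees must stay below p, which needs t^3 = O(p^2); for t > p^(5/8) part (ii) already
    gives the conclusion. *)

Set Implicit Arguments. Unset Strict Implicit. Unset Printing Implicit Defensive.
Import Order.TTheory GRing.Theory Num.Theory.

(** * Stepanov's method *)

Section Stepanov.
Local Open Scope ring_scope.

Lemma underdetermined_solution (F : fieldType) (I J : finType) (f : I -> J -> F) :
  (#|J| < #|I|)%N ->
  exists lam : I -> F, (exists i, lam i != 0) /\ forall j, \sum_i lam i * f i j = 0.
Proof.
move=> ltJI.
pose M := \matrix_(i < #|I|, j < #|J|) f (enum_val i) (enum_val j).
have : kermx M != 0.
  rewrite kermx_eq0 /row_free; apply/eqP=> rkM.
  by have := rank_leq_col M; rewrite rkM leqNgt ltJI.
case/rowV0Pn=> v /sub_kermxP vM /rV0Pn [i0 vi0].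
exists (fun i => v 0 (enum_rank i)); split.
  by exists (enum_val i0); rewrite enum_valK.
move=> j; have := congr1 (fun N : 'rV_#|J| => N 0 (enum_rank j)) vM.
rewrite !mxE; apply: etrans; rewrite (reindex (@enum_val I I)) /=; last first.
  exact/onW_bij/enum_val_bij.
by apply: eq_bigr => i _; rewrite enum_valK mxE !enum_rankK.
Qed.

Lemma multiplicity_size_bound (F : fieldType) (A : nat) (us : seq F) (q : {poly F}) :
  q != 0 -> uniq us -> (forall u, u \in us -> ('X - u%:P) ^+ A %| q) ->
  (A * size us < size q)%N.
Proof.
elim: us q => [|u us IH] q q0 /=; first by rewrite muln0 size_poly_gt0.
case/andP=> uus uqus dvq.
have /dvdpP [h hE] := dvq u (mem_head _ _).
have h0 : h != 0 by apply: contraNneq q0 => h0; rewrite hE h0 mul0r.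
have := IH h h0 uqus; rewrite hE size_mul ?expf_neq0 ?polyXsubC_eq0 //.
rewrite size_exp_XsubC mulnS addnS /= => IHh.
suff hA : (A * size us < size h)%N by rewrite addnC ltn_add2r.
apply: IHh => v vus.
have := dvq v; rewrite inE vus orbT hE Gauss_dvdpl ?coprimep_expl ?coprimep_expr //; first by apply.
rewrite coprimep_XsubC root_XsubC.
by apply: contraNneq uus => ->.
Qed.

Variables (F : fieldType) (p : nat).
Hypothesis natF_neq0 : forall n, (0 < n < p)%N -> n%:R != 0 :> F.

Lemma natF_inj (m n : nat) : (m < p)%N -> (n < p)%N -> m%:R = n%:R :> F -> m = n.
Proof.
move=> mp np eqmn; wlog lemn : m n mp np eqmn / (m <= n)%N.
  by move=> wl; case/orP: (leq_total m n) => ?; [exact: wl | symmetry; exact: wl].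
apply/eqP; rewrite eqn_leq lemn leqNgt; apply/negP => ltmn.
have /negP [] : (n - m)%:R != 0 :> F by apply: natF_neq0; lia.
by rewrite natrB // eqmn subrr.
Qed.

(* [X f' - e f] kills the monomial of degree [e] and costs one order of vanishing. *)
Lemma sparse_poly_eq0 (f : {poly F}) (s : seq nat) :
  (forall k, k \in s -> (k < p)%N) -> (forall k, k \notin s -> f`_k = 0) ->
  ('X - 1%:P) ^+ size s %| f -> f = 0.
Proof.
elim: s f => [|e s IH] f sp fs dvf; first by apply/polyP=> k; rewrite fs // coef0.
have ep : (e < p)%N by apply: sp; rewrite mem_head.
have [h hE] := dvdpP _ _ dvf.
have coefg k : ('X * f^`() - e%:R *: f)`_k = (k%:R - e%:R) * f`_k.
  rewrite coefB coefZ coefXM coef_deriv mulrBl; case: k => [|k] /=; first by rewrite mul0r.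
  by rewrite -[f`_k.+1 *+ _]mulr_natl.
have g0 : 'X * f^`() - e%:R *: f = 0.
  apply: IH => [k ks|k ks|]; first by apply: sp; rewrite inE ks orbT.
    rewrite coefg; have [->|ke] := eqVneq k e; first by rewrite subrr mul0r.
    by rewrite fs ?mulr0 // inE negb_or ke.
  rewrite hE derivM deriv_exp derivXsubC mul1r /= exprS.
  set Y := 'X - _; apply/dvdpP.
  exists ('X * (h^`() * Y + h * (size s).+1%:R) - e%:R *: (h * Y)).
  by rewrite -!mul_polyC; ring.
have fk k : k != e -> f`_k = 0.
  move=> ke; have := coefg k; rewrite g0 coef0 => /esym/eqP; rewrite mulf_eq0 subr_eq0.
  case/orP=> [/eqP eqke|/eqP //].
  have [kp|kp] := ltnP k p; first by have := natF_inj kp ep eqke; move/eqP; rewrite (negPf ke).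
  by apply: fs; apply/negP=> /sp; rewrite ltnNge kp.
have fE : f = f`_e *: 'X^e.
  apply/polyP=> k; rewrite coefZ coefXn; have [->|ke] := eqVneq k e; first by rewrite mulr1.
  by rewrite mulr0 fk.
have : f.[1] = 0 by rewrite hE /= exprS !hornerM hornerXsubC subrr mul0r mulr0.
by rewrite fE !hornerE expr1n mulr1 => ->; rewrite scale0r.
Qed.

(** This derivation stands in for the ordinary derivative because it maps [X^b (X-1)^c g] to
    [X^b (X-1)^c] times a polynomial, without lowering [b] or [c]. *)
Definition theta (f : {poly F}) : {poly F} := 'X * ('X - 1) * f^`().

(** Away from 0 and 1 the factor [X (X-1)] does not vanish, so iterates of [theta] detect
    multiplicity as derivatives do: a zero of [f] of exact order [D], [0 < D < p], has order [D - 1]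
    in [theta f], because [D] is nonzero in [F]. *)
Lemma theta_iter_dvdp (D : nat) (f : {poly F}) (u : F) :
  (D <= p)%N -> u != 0 -> u != 1 ->
  (forall n, (n < D)%N -> (iter n theta f).[u] = 0) -> ('X - u%:P) ^+ D %| f.
Proof.
move=> Dp u0 u1; elim: D Dp f => [|D IH] Dp f fu; first by rewrite dvd1p.
have /dvdpP [h hE] : ('X - u%:P) ^+ D %| f.
  by apply: IH => [|n nD]; [lia | apply: fu; lia].
suff : root h u.
  move=> hu; rewrite hE exprS mulrC [h * _]mulrC.
  by rewrite dvdp_mul2l ?dvdp_XsubCl ?expf_neq0 ?polyXsubC_eq0.
case: D Dp IH hE fu => [|D] Dp IH hE fu.
  by have := fu 0%N isT; rewrite /= hE expr0 mulr1 => /rootP.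
have : ('X - u%:P) ^+ D.+1 %| theta f.
  by apply: IH => [|n nD]; [lia | rewrite -iterSr; apply: fu].
have -> : theta f = ('X - u%:P) ^+ D * ('X * ('X - 1) * (h^`() * ('X - u%:P) + h * D.+1%:R)).
  by rewrite /theta hE derivM deriv_exp derivXsubC mul1r /= exprS; ring.
rewrite exprSr dvdp_mul2l ?expf_neq0 ?polyXsubC_eq0 // dvdp_XsubCl => /rootP.
rewrite -[1]/(1%:P) -polyC_natr !hornerE subrr mulr0 add0r => /eqP.
rewrite !mulf_eq0 (negPf u0) subr_eq0 (negPf u1) /= => /orP [//|].
by rewrite (negPf (natF_neq0 _)) //; lia.
Qed.

(** The action of [theta] on the cofactor [g] once the prefactor [X^b (X-1)^c] is stripped off. *)
Definition theta_twist (b c : F) (g : {poly F}) : {poly F} :=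
  'X * ('X - 1) * g^`() + (b *: ('X - 1) + c *: 'X) * g.

Lemma theta_twistE (b c : nat) (g : {poly F}) :
  theta ('X^b * ('X - 1) ^+ c * g) = 'X^b * ('X - 1) ^+ c * theta_twist b%:R c%:R g.
Proof.
rewrite /theta /theta_twist !derivM derivXn deriv_exp derivB derivX -[1]/(1%:P) derivC subr0 mul1r.
rewrite -!mul_polyC !polyC_natr.
case: b => [|b]; case: c => [|c] /=; rewrite ?exprS ?expr0; ring.
Qed.

Lemma theta_twist_iterE (b c n : nat) (g : {poly F}) :
  iter n theta ('X^b * ('X - 1) ^+ c * g) = 'X^b * ('X - 1) ^+ c * iter n (theta_twist b%:R c%:R) g.
Proof. by elim: n => //= n ->; rewrite theta_twistE. Qed.

Lemma size_theta_twist (b c : F) (g : {poly F}) (m : nat) :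
  (size g <= m)%N -> (size (theta_twist b c g) <= m.+1)%N.
Proof.
move=> gm; have X1 : size ('X - 1 : {poly F}) = 2 by rewrite -[1]/(1%:P) size_XsubC.
have X2 : (size ('X * ('X - 1) : {poly F})%R <= 3)%N.
  by apply: leq_trans (size_polyMleq _ _) _; rewrite size_polyX X1.
apply: leq_trans (size_polyD _ _) _; rewrite geq_max; apply/andP; split.
  have [->|g0] := eqVneq g 0; first by rewrite deriv0 mulr0 size_poly0.
  apply: leq_trans (size_polyMleq _ _) _.
  have aux x y : (x <= 3 -> y < m -> (x + y).-1 <= m.+1)%N by lia.
  exact: aux X2 (leq_trans (lt_size_deriv g0) gm).
have sl : (size (b *: ('X - 1) + c *: 'X)%R <= 2)%N.
  apply: leq_trans (size_polyD _ _) _; rewrite geq_max.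
  by rewrite (leq_trans (size_scale_leq _ _)) ?X1 // (leq_trans (size_scale_leq _ _)) ?size_polyX.
apply: leq_trans (size_polyMleq _ _) _.
have aux x y : (x <= 2 -> y <= m -> (x + y).-1 <= m.+1)%N by lia.
exact: aux sl gm.
Qed.

Lemma size_theta_twist_iter (b c : F) (g : {poly F}) (n m : nat) :
  (size g <= m)%N -> (size (iter n (theta_twist b c) g) <= m + n)%N.
Proof.
move=> gm; elim: n => [|n IH] /=; first by rewrite addn0.
by rewrite addnS size_theta_twist.
Qed.

Lemma theta_iter_sum (I : finType) (lam : I -> F) (f : I -> {poly F}) n :
  iter n theta (\sum_i lam i *: f i) = \sum_i lam i *: iter n theta (f i).
Proof.
elim: n => //= n ->; rewrite /theta linear_sum mulr_sumr; apply: eq_bigr => i _.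
by rewrite linearZ -scalerAr.
Qed.

(** This keeps the Stepanov combination from being zero. The term with [c = 0] is divisible by
    [(X-1)^t] but has at most [A * B <= t] monomials, all of degree below [p], so [sparse_poly_eq0]
    kills it; then [(X-1)^t] is cancelled and the induction goes on. *)
Lemma stepanov_family_free (t A B C : nat) (f : 'I_C -> {poly F}) :
  (A * B <= t)%N -> (A <= t)%N -> (t * B <= p)%N ->
  (forall c k, (forall (a : 'I_A) (b : 'I_B), k != (t * b + a)%N) -> (f c)`_k = 0) ->
  \sum_(c < C) ('X - 1) ^+ (t * c) * f c = 0 -> forall c, f c = 0.
Proof.
move=> ABt At tBp; elim: C f => [|C IH] f fk; first by move=> _ [].
rewrite big_ord_recl muln0 expr0 mul1r.
under eq_bigr => i _ do rewrite lift0 mulnS exprD -mulrA.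
rewrite -mulr_sumr => /eqP; rewrite addr_eq0 => /eqP f0E.
have f0 : f ord0 = 0.
  apply: (sparse_poly_eq0 (s := [seq (t * ab.2 + ab.1)%N | ab : 'I_A * 'I_B])).
  - move=> k /mapP [[a b] _ ->] /=; have := ltn_ord a; have := ltn_ord b; nia.
  - move=> k kn; apply: fk => a b; apply: contraNneq kn => ->.
    by apply/mapP; exists (a, b); rewrite ?mem_enum.
  - rewrite size_map -cardE card_prod !card_ord f0E dvdpNr dvdp_mulr //.
    by rewrite -(subnK ABt) exprD dvdp_mull.
have fS : \sum_(c < C) ('X - 1) ^+ (t * c) * f (lift ord0 c) = 0.
  move/eqP: f0E; rewrite f0 eq_sym oppr_eq0 mulf_eq0 expf_eq0 -[1]/(1%:P) polyXsubC_eq0 andbF /=.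
  by move/eqP.
move=> c; case: (unliftP ord0 c) => [c' ->|->] //.
by apply: (IH (fun c => f (lift ord0 c))) => // ? ?; apply: fk.
Qed.

(** A combination of the [A * B^2] products [X^a X^(t b) (X-1)^(t c)] is made to vanish to order [A]
    at every point. There [u^t = (u-1)^t = h], so each [h] in [H] and each order [n < A] cost [2 A]
    linear conditions, [2 |H| A^2] in total; the degree is below [2 t B]. *)
Lemma stepanov_bound (t A B : nat) (H us : seq F) :
  (0 < A)%N -> (0 < B)%N -> (A * B <= t)%N -> (t * B <= p)%N -> (2 * size H * A < B * B)%N ->
  uniq us ->
  (forall u, u \in us -> [/\ u != 0, u != 1, u ^+ t = (u - 1) ^+ t & u ^+ t \in H]) ->
  (A * size us <= 2 * t * B)%N.
Proof.
move=> A0 B0 ABt tBp sB uqus usP.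
have At : (A <= t)%N by nia.
(* An unknown is indexed by [((a, b), c)], an equation by [((h, n), k)]: position in [H], order of
   derivation, coefficient. *)
pose I : finType := ('I_A * 'I_B * 'I_B)%type.
pose J : finType := ('I_(size H) * 'I_A * 'I_(A + A))%type.
pose P n (i : I) : {poly F} := iter n (theta_twist (t * i.1.2)%:R (t * i.2)%:R) 'X^(i.1.1).
pose mon (i : I) : {poly F} := 'X^(t * i.1.2) * ('X - 1) ^+ (t * i.2) * 'X^(i.1.1).
have [|lam [[i0 lam0] lamP]] := @underdetermined_solution F I J
    (fun i j => H`_j.1.1 ^+ (i.1.2 + i.2) * (P j.1.2 i)`_j.2).
  by rewrite !card_prod !card_ord; nia.
pose Psi := \sum_i lam i *: mon i.
have Psi_dvd u : u \in us -> ('X - u%:P) ^+ A %| Psi.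
  case/usP=> u0 u1 ut uH; apply: theta_iter_dvdp => //; first by nia.
  move=> n nA; rewrite theta_iter_sum horner_sum.
  have /= jH := uH; rewrite -index_mem in jH.
  (* In [Q] the values [u^(t b) (u-1)^(t c)] are replaced by the constant [h^(b + c)], so each
     coefficient below [A + A] is an equation solved by [lam], and the others vanish by degree. *)
  pose Q := \sum_i (lam i * (u ^+ t) ^+ (i.1.2 + i.2)) *: P n i.
  have Q0 : Q = 0.
    apply/polyP=> k; rewrite coef0 coef_sum.
    have [kA|kA] := ltnP k (A + A); last first.
      rewrite big1 // => i _; rewrite coefZ nth_default ?mulr0 //.
      apply: leq_trans kA; apply: (leq_trans (size_theta_twist_iter _ _ _ (m := A) _)); last by lia.
      by rewrite size_polyXn.
    rewrite -[RHS](lamP (Ordinal jH, Ordinal nA, Ordinal kA)).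
    by apply: eq_bigr => i _; rewrite coefZ /= nth_index // mulrA.
  transitivity Q.[u]; last by rewrite Q0 horner0.
  rewrite horner_sum; apply: eq_bigr => i _; rewrite !hornerZ -mulrA; congr (_ * _).
  rewrite /mon theta_twist_iterE hornerM; congr (_ * _).
  by rewrite -[1]/(1%:P) !hornerE !exprM -ut -exprD.
pose f (c : 'I_B) : {poly F} := \sum_(ab : 'I_A * 'I_B) lam (ab, c) *: 'X^(t * ab.2 + ab.1).
have Psi_split : Psi = \sum_(c < B) ('X - 1) ^+ (t * c) * f c.
  under [RHS]eq_bigr => c _ do rewrite mulr_sumr.
  rewrite exchange_big pair_bigA /=; apply: eq_bigr => [[[a b] c]] _ /=.
  by rewrite -scalerAr /mon exprD /=; congr (_ *: _); ring.
have Psi0 : Psi != 0.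
  apply/negP=> /eqP P0; case/negP: lam0; case: i0 => [[a0 b0] c0].
  have : f c0 = 0.
    apply: (stepanov_family_free ABt At tBp); last by rewrite -Psi_split.
    move=> c k kab; rewrite coef_sum big1 // => [[a b]] _.
    by rewrite coefZ coefXn (negPf (kab a b)) mulr0.
  move/(congr1 (fun g : {poly F} => g`_(t * b0 + a0))); rewrite coef0 coef_sum.
  rewrite (bigD1 (a0, b0)) //= coefZ coefXn eqxx mulr1 big1 ?addr0 => [->//|[a b] /= nab].
  rewrite coefZ coefXn; have [eqab|] := eqVneq; last by rewrite mulr0.
  have lt_t (x : 'I_A) : (x < t)%N by apply: leq_trans At.
  have modE (x : 'I_A) (y : 'I_B) : ((t * y + x) %% t)%N = x.
    by rewrite mulnC modnMDl modn_small.
  have divE (x : 'I_A) (y : 'I_B) : ((t * y + x) %/ t)%N = y.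
    by rewrite mulnC divnMDl ?divn_small ?addn0 // (leq_trans A0).
  case/negP: nab; rewrite xpair_eqE -!val_eqE /=.
  rewrite -[X in X == _ :> nat](modE a b) -eqab modE eqxx.
  by rewrite -[X in X == _ :> nat](divE a b) -eqab divE eqxx.
have size_Psi : (size Psi <= 2 * t * B)%N.
  apply: leq_trans (size_sum _ _ _) _; apply/bigmax_leqP=> [[[a b] c]] _.
  apply: leq_trans (size_scale_leq _ _) _; rewrite /mon /=.
  have s1 : (size ('X^(t * b) * ('X - 1) ^+ (t * c) : {poly F})%R <= (t * b + t * c).+1)%N.
    by apply: leq_trans (size_polyMleq _ _) _; rewrite size_polyXn size_exp_XsubC addSn addnS.
  apply: leq_trans (size_polyMleq _ _) _; rewrite size_polyXn addnS /=.
  apply: leq_trans (leq_add s1 (leqnn _)) _.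
  by have := ltn_ord a; have := ltn_ord b; have := ltn_ord c; move: At; clear; nia.
exact: leq_trans (ltnW (multiplicity_size_bound Psi0 uqus Psi_dvd)) size_Psi.
Qed.

End Stepanov.

(** * Additive energy *)

(** Choice of [A] and [B], with [s = |H|] and [N] the number of points: [A] is of order
    [(t^2 / s)^(1/3)] and [B] of order [t / A]. Then [A * N <= 2 t B] gives [A^2 s tau <= 2 t^2],
    and cubing eliminates [A]. *)
Lemma stepanov_parameters (p t s tau N : nat) :
  0 < s -> 8 < t -> s * tau <= N -> N <= t -> t <= tau ^ 2 -> 16 * t ^ 3 <= p ^ 2 ->
  (forall A B, 0 < A -> 0 < B -> A * B <= t -> t * B <= p -> 2 * s * A < B * B ->
     A * N <= 2 * t * B) ->
  s * tau ^ 3 <= 32 ^ 3 * t ^ 2.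
Proof.
move=> s0 t8 stN Nt ttau tp stepanov.
have st : s ^ 2 <= t.
  rewrite -(leq_pmul2r (_ : 0 < t)) ?(leq_trans _ t8) // mulnn.
  have := leq_mul (leqnn (s ^ 2)) ttau; move/leq_trans; apply.
  by rewrite -expnMn leq_exp2r // (leq_trans stN).
(* The constant 8 makes [2 s A < B^2] follow from [t < 2 A B]. *)
pose P A := 8 * s * A ^ 3 < t ^ 2.
have P1 : exists A, P A by exists 1; rewrite /P; nia.
have Pmax A : P A -> A <= t ^ 2 by rewrite /P; clear -s0; nia.
case: (ex_maxnP P1 Pmax) => A PA Amax.
have A0 : 0 < A by apply: Amax; rewrite /P; clear -st t8; nia.
have At : A < t.
  apply: contraTT PA; rewrite /P -!leqNgt => tA.
  apply: (@leq_trans (A ^ 3)); last by rewrite leq_pmull // muln_gt0.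
  by apply: (@leq_trans (t ^ 3)); rewrite ?leq_exp2r // leq_pexp2l //; lia.
have Abig : t ^ 2 <= 64 * s * A ^ 3.
  have : ~~ P A.+1 by apply/negP=> /Amax; rewrite ltnn.
  rewrite /P -leqNgt => /leq_trans; apply.
  by have : A.+1 ^ 3 <= (2 * A) ^ 3; [rewrite leq_exp2r //; lia | clear; nia].
(* Combined with [16 t^3 <= p^2] this gives [t^2 <= A p], hence the degree condition [t B <= p]. *)
have At2 : t <= 16 * A ^ 2.
  rewrite -(@leq_exp2r _ _ 3) //.
  have t0 : 0 < t by lia.
  rewrite -(leq_pmul2r t0) -expnSr.
  have -> : (16 * A ^ 2) ^ 3 * t = t * (64 * A ^ 3) ^ 2 by ring.
  apply: (@leq_trans (s ^ 2 * (64 * A ^ 3) ^ 2)); last by rewrite leq_mul2r st orbT.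
  by rewrite -expnMn (expnM t 2 2) leq_exp2r // mulnCA mulnA.
have tAp : t ^ 2 <= A * p.
  rewrite -(@leq_exp2r _ _ 2) // expnMn.
  have := leq_mul At2 tp; clear; nia.
pose B := t %/ A.
have B0 : 0 < B by rewrite divn_gt0 // ltnW.
have ABt : A * B <= t by rewrite mulnC leq_trunc_div.
have tAB : t < 2 * (A * B).
  have := ltn_ceil t A0; rewrite -/B; clear -A0 B0; nia.
have tBp : t * B <= p by rewrite -(leq_pmul2l A0); move: tAp ABt; clear; nia.
have sAB : 2 * s * A < B * B.
  have lt2 : t ^ 2 < (2 * (A * B)) ^ 2 by rewrite ltn_exp2r.
  rewrite -(ltn_pmul2l (_ : 0 < 4 * A ^ 2)) ?muln_gt0 ?expn_gt0 ?A0 //.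
  have -> : 4 * A ^ 2 * (2 * s * A) = 8 * s * A ^ 3 by ring.
  have -> : 4 * A ^ 2 * (B * B) = (2 * (A * B)) ^ 2 by ring.
  exact: ltn_trans PA lt2.
have := stepanov A B A0 B0 ABt tBp sAB => main.
have {main} main : A ^ 2 * (s * tau) <= 2 * t ^ 2.
  apply: (@leq_trans (A * (A * N))); first by rewrite -mulnn -mulnA !leq_mul2l stN !orbT.
  apply: (@leq_trans (A * (2 * t * B))); first by rewrite leq_mul2l main orbT.
  by move: ABt; clear; nia.
have main3 : (A ^ 2 * (s * tau)) ^ 3 <= (2 * t ^ 2) ^ 3 by rewrite leq_exp2r.
have big2 : (t ^ 2) ^ 2 <= (64 * s * A ^ 3) ^ 2 by rewrite leq_exp2r.
have t40 : 0 < t ^ 4 by rewrite expn_gt0; lia.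
rewrite -(leq_pmul2l t40).
apply: (@leq_trans ((64 * s * A ^ 3) ^ 2 * (s * tau ^ 3))).
  by rewrite (expnM t 2 2) leq_mul2r big2 orbT.
have -> : (64 * s * A ^ 3) ^ 2 * (s * tau ^ 3) = 16 ^ 3 * (A ^ 2 * (s * tau)) ^ 3.
  by ring.
have -> : t ^ 4 * (32 ^ 3 * t ^ 2) = 16 ^ 3 * (2 * t ^ 2) ^ 3.
  by ring.
by rewrite leq_mul2l main3 orbT.
Qed.

(** The bound [a tau <= M / tau^2 <= M (1/(tau-1) - 1/tau)] telescopes to [M / (T-1)]; the factor 2
    covers [T / (T-1)]. *)
Lemma sum_inverse_square_bound (a : nat -> nat) (M T N : nat) :
  2 <= T -> (forall tau, T <= tau -> a tau * tau ^ 2 <= M) ->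
  T * (\sum_(T <= tau < N) a tau) <= 2 * M.
Proof.
case: T => // k k1 aM; have [NT|TN] := leqP N k.+1; first by rewrite big_geq // muln0.
have k0 : (0 < k%:R :> rat)%R by rewrite ltr0n.
have telescope m : ((\sum_(k.+1 <= tau < k.+1 + m) a tau)%:R
    <= M%:R * (k%:R^-1 - (k + m)%:R^-1) :> rat)%R.
  elim: m => [|m IH]; first by rewrite !addn0 big_geq // subrr mulr0.
  rewrite addnS big_nat_recr ?leq_addr //= natrD.
  have km0 : (0 < (k + m)%:R :> rat)%R by rewrite ltr0n; lia.
  have := aM (k.+1 + m) (leq_addr _ _); rewrite -(ler_nat rat) natrM natrX => aMm.
  have -> : (M%:R * (k%:R^-1 - (k + m.+1)%:R^-1) = M%:R * (k%:R^-1 - (k + m)%:R^-1)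
      + M%:R * ((k + m)%:R^-1 - (k + m.+1)%:R^-1) :> rat)%R by ring.
  apply: lerD => //; move: aMm; rewrite addSn addnS -natr1.
  set z : rat := ((k + m)%:R)%R in km0 *; set y := ((a _)%:R)%R => aMm.
  have z1 : (0 < z + 1)%R by lra.
  have -> : (M%:R * (z^-1 - (z + 1)^-1) = M%:R / (z * (z + 1)))%R by field; lra.
  rewrite ler_pdivlMr ?mulr_gt0 //; apply: le_trans aMm.
  by rewrite ler_wpM2l ?ler0n // expr2; nra.
have := telescope (N - k.+1); rewrite subnKC; last by lia.
set S := \sum_(_ <= _ < _) _ => tele.
suff : k * S <= M by clear -k1; nia.
rewrite -(ler_nat rat) natrM mulrC -ler_pdivlMr //; apply: le_trans tele _.
by rewrite ler_wpM2l ?ler0n // lerBlDr lerDl invr_ge0 ler0n.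
Qed.

Lemma Fp_nat_neq0 (p : nat) : prime p -> forall n, 0 < n < p -> (n%:R != 0 :> 'F_p)%R.
Proof.
move=> pp n /andP [n0 np]; rewrite -(dvdn_pcharf (pchar_Fp pp)).
by apply/negP=> /dvdn_leq; lia.
Qed.

Lemma card_power_fiber (F : finFieldType) (t : nat) (y : F) :
  0 < t -> #|[set x : F | x ^+ t == y]%R| <= t.
Proof.
move=> t0; have q0 : ('X^t - y%:P != 0 :> {poly F})%R.
  by rewrite -size_poly_eq0 size_XnsubC.
have := max_poly_roots q0 (rs := enum [set x : F | x ^+ t == y]%R).
rewrite size_XnsubC // enum_uniq -cardE ltnS; apply=> //.
by apply/allP=> x; rewrite mem_enum inE /root !hornerE subr_eq0.
Qed.

(** Up to [T] the bound [r^2 <= T r] is enough; beyond, [(r+1)^2 - r^2 <= 2 (r+1)]. The common cap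
    [m] makes the range of [tau] independent of [r], so that the sum can be exchanged with one over
    [x]. *)
Lemma square_layer_cake (T m r : nat) :
  (r <= m) -> (r ^ 2 <= T * r + \sum_(T <= tau < m.+1 | tau <= r) 2 * tau).
Proof.
move=> rm; have <- : \sum_(T <= tau < r.+1) 2 * tau = \sum_(T <= tau < m.+1 | tau <= r) 2 * tau.
  by rewrite (big_nat_widen T r.+1 m.+1) //; apply: eq_bigl.
elim: r {rm} => [|r IH]; first by rewrite exp0n.
have [rT|Tr] := ltnP r T; first by rewrite -mulnn (leq_trans _ (leq_addr _ _)) // leq_mul2r rT orbT.
rewrite big_nat_recr ?(leq_trans Tr) //=; move: IH; clear; nia.
Qed.

Definition diff_rep (p : nat) (G : {set 'F_p}) (x : 'F_p) : nat :=
  #|[set r in G | r - x \in G]%R|.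

Definition energy (p : nat) (G : {set 'F_p}) : nat := \sum_x diff_rep G x ^ 2.

Section Subgroup.
Local Open Scope ring_scope.
Variables (p : nat) (G : {set 'F_p}).
Hypotheses (p_prime : prime p) (subG : mult_subgroup G).

Lemma subgroup_card_gt0 : (0 < #|G|)%N.
Proof. by case: subG => _ G1 _ _; apply/card_gt0P; exists 1. Qed.

Lemma subgroup_neq0 r : r \in G -> r != 0.
Proof. by case: subG => G0 _ _ _ rG; apply: contraNneq G0 => <-. Qed.

Lemma subgroup_mulr r x : r \in G -> (x * r \in G) = (x \in G).
Proof.
case: subG => _ _ GM GV rG; apply/idP/idP => [xrG|xG]; last exact: GM.
by rewrite -[x](mulfK (subgroup_neq0 rG)) GM // GV.
Qed.

Lemma subgroup_sum_mulr (V : nmodType) (f : 'F_p -> V) r :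
  r \in G -> \sum_(x in G) f (x * r) = \sum_(x in G) f x.
Proof.
move=> rG; rewrite [RHS](reindex_inj (mulIf (subgroup_neq0 rG))).
by apply: eq_bigl => x; rewrite subgroup_mulr.
Qed.

(** Multiplication by [r] permutes [G], so it leaves the product of all elements unchanged while
    scaling it by [r^|G|]. *)
Lemma subgroup_expr_card r : r \in G -> r ^+ #|G| = 1.
Proof.
move=> rG; have r0 := subgroup_neq0 rG.
have P0 : \prod_(x in G) x != 0 by apply/prodf_neq0 => x; apply: subgroup_neq0.
apply: (mulIf P0); rewrite mul1r [RHS](reindex_inj (mulfI r0)) -prodr_const -big_split /=.
by apply: eq_bigl => x; rewrite [r * x]mulrC subgroup_mulr.
Qed.

Lemma diff_rep_sum : (\sum_x diff_rep G x = #|G| ^ 2)%N.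
Proof.
under eq_bigr => x _ do rewrite /diff_rep -sum1_card.
transitivity (\sum_x \sum_(r in G) ((r - x)%R \in G))%N.
  apply: eq_bigr => x _; rewrite [RHS]big_mkcond [LHS]big_mkcond; apply: eq_bigr => r _.
  by rewrite inE; case: (r \in G); case: (r - x \in G)%R.
rewrite exchange_big /= -mulnn -sum_nat_const; apply: eq_bigr => r _.
rewrite (reindex_inj (inj_comp (addrI r) (@oppr_inj _))) /= -sum1_card [RHS]big_mkcond.
by apply: eq_bigr => x _; rewrite subKr; case: (x \in G).
Qed.

Lemma diff_rep0 : diff_rep G 0 = #|G|.
Proof. by apply: eq_card => r; rewrite !inE subr0 andbb. Qed.

Lemma diff_rep_le x : (diff_rep G x <= #|G|)%N.
Proof. by apply: subset_leq_card; apply/subsetP => r; rewrite inE => /andP []. Qed.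

(** If [r] and [r - x] lie in [G], then [u = r / x] satisfies [u^t = (u-1)^t = x^-t]: popular
    differences yield points for Stepanov's method. Each value [x^-t] comes from at most [t]
    elements [x]. *)
Lemma popular_differences_bound (tau : nat) :
  (8 < #|G|)%N -> (16 * #|G| ^ 3 <= p ^ 2)%N -> (#|G| <= tau ^ 2)%N ->
  (#|[set x | (x != 0)%R && (tau <= diff_rep G x)]| * tau ^ 3 <= 32 ^ 3 * #|G| ^ 3)%N.
Proof.
set t := #|G| => t8 tp ttau; set X := [set x | _].
have t0 : (0 < t)%N by exact: subgroup_card_gt0.
pose H := [set x^-1 ^+ t | x in X].
pose U := [set u : 'F_p | [&& u != 0, u != 1, u ^+ t == (u - 1) ^+ t & u ^+ t \in H]].
have XH : (#|X| <= t * #|H|)%N.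
  rewrite -sum1_card (partition_big (fun x => x^-1 ^+ t) (mem H)) /=; last first.
    by move=> x xX; apply: imset_f.
  rewrite mulnC -sum_nat_const; apply: leq_sum => h _.
  rewrite sum1_card; apply: leq_trans (card_power_fiber h^-1 t0).
  apply: subset_leq_card; apply/subsetP=> x; rewrite unfold_in /= !inE => /andP [_ /eqP <-].
  by rewrite exprVn invrK.
(* The fibre of [U] over [h = x^-t] contains the quotients [r / x], one for each representation of
   [x]. *)
have HU : (#|H| * tau <= #|U|)%N.
  rewrite -sum_nat_const -(sum1_card (mem U)).
  rewrite [X in (_ <= X)%N](partition_big (fun u => u ^+ t) (mem H)) /=; last first.
    by move=> u; rewrite inE => /and4P [].
  apply: leq_sum => h hH; have /imsetP [x xX hE] := hH.
  move: xX; rewrite inE => /andP [x0 taux]; apply: leq_trans taux _.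
  rewrite sum1_card /diff_rep -(card_imset _ (mulIf (invr_neq0 x0))).
  apply: subset_leq_card; apply/subsetP=> _ /imsetP [r + ->].
  rewrite inE => /andP [rG rxG]; rewrite unfold_in /= inE.
  have -> : r / x - 1 = (r - x) / x by field.
  have powE y : y \in G -> (y / x) ^+ t = h.
    by move=> yG; rewrite exprMn subgroup_expr_card // mul1r hE.
  rewrite !powE // hH !eqxx !andbT.
  rewrite mulf_neq0 ?invr_neq0 ?(subgroup_neq0 rG) //=.
  by rewrite -(inj_eq (mulIf x0)) divfK // mul1r -subr_eq0 (subgroup_neq0 rxG).
(* The injective map [u -> 1 - 1/u] sends [U] into the [t]-th roots of unity. *)
have Ut : (#|U| <= t)%N.
  apply: leq_trans (card_power_fiber (1 : 'F_p) t0).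
  rewrite -(card_imset _ (inj_comp (addrI 1) (inj_comp (@oppr_inj _) (@invr_inj _)))).
  apply: subset_leq_card; apply/subsetP=> _ /imsetP [u + ->].
  rewrite !inE /= => /and4P [u0 u1 /eqP ut _].
  have -> : 1 - u^-1 = (u - 1) / u by field.
  by rewrite exprMn -ut exprVn divff // expf_neq0.
have [H0|H0] := posnP #|H|; first by move: XH; rewrite H0 muln0 leqn0 => /eqP ->.
suff st : (#|H| * tau ^ 3 <= 32 ^ 3 * t ^ 2)%N.
  apply: leq_trans (leq_mul XH (leqnn _)) _; rewrite -mulnA (expnS t) [X in (_ <= X)%N]mulnCA leq_mul2l.
  by rewrite st orbT.
apply: (@stepanov_parameters p t #|H| tau #|U|) => // A B A0 B0 ABt tBp HAB.
have := @stepanov_bound 'F_p p (Fp_nat_neq0 p_prime) t A B (enum H) (enum U).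
rewrite -!cardE; apply=> //; first exact: enum_uniq.
by move=> u; rewrite mem_enum inE mem_enum => /and4P [u0 u1 /eqP ut uH].
Qed.

End Subgroup.

(** This is [E = O(t^(5/2))], squared to stay in the integers. With [T] of order [sqrt t], the
    difference 0 gives [t^2], the levels below [T] give at most [T t^2], and those above give
    [O(t^3 / T)] by [popular_differences_bound]. *)
Theorem energy_bound : exists K : nat, forall (p : nat) (G : {set 'F_p}),
  prime p -> mult_subgroup G -> 8 < #|G| -> 16 * #|G| ^ 3 <= p ^ 2 ->
  energy G ^ 2 <= K * #|G| ^ 5.
Proof.
exists ((8 + 4 * 32 ^ 3) ^ 2) => p G pp sG t8 tp.
set t := #|G| in t8 tp *; move: (32 ^ 3) (popular_differences_bound pp sG) => K popular.
have exT : exists T, t <= T ^ 2 by exists t; rewrite -mulnn leq_pmulr //; lia.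
(* Minimality of [T] gives [(T-1)^2 < t], hence [T^2 <= 4 t]. *)
case: (ex_minnP exT) => T tT Tmin.
have T2 : 2 < T by rewrite -(@ltn_exp2r _ _ 2) // (leq_trans _ tT) // (leq_trans _ t8).
have Tt : T ^ 2 <= 4 * t.
  have : T.-1 ^ 2 < t by rewrite ltnNge; apply/negP => /Tmin; lia.
  by move: T2; clear; nia.
pose n tau := #|[set x | (x != 0)%R && (tau <= diff_rep G x)]|.
have En : energy G <= t ^ 2 + T * t ^ 2 + \sum_(T <= tau < t.+1) 2 * tau * n tau.
  rewrite /energy (bigD1 0%R) //= diff_rep0 -addnA leq_add2l.
  apply: (@leq_trans (\sum_(x | (x != 0)%R)
      (T * diff_rep G x + \sum_(T <= tau < t.+1 | tau <= diff_rep G x) 2 * tau))).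
    by apply: leq_sum => x _; apply: square_layer_cake; apply: diff_rep_le.
  rewrite big_split /= leq_add //.
    rewrite -big_distrr /= leq_mul2l -/t -diff_rep_sum; apply/orP; right.
    by rewrite [X in _ <= X](bigD1 0%R) //= leq_addl.
  rewrite (exchange_big_dep predT) //=; apply: leq_sum => tau _.
  rewrite sum_nat_const mulnC leq_mul2l; apply/orP; right.
  by apply: subset_leq_card; apply/subsetP => x; rewrite !inE.
set S := \sum_(_ <= _ < _) _ in En.
have TS : T * S <= 4 * K * t ^ 3.
  have -> : 4 * K * t ^ 3 = 2 * (2 * K * t ^ 3) by ring.
  apply: sum_inverse_square_bound => [|tau Ttau]; first exact: ltnW.
  have := popular tau t8 tp; rewrite -/t -/(n tau) => popt.
  have -> : 2 * tau * n tau * tau ^ 2 = 2 * (n tau * tau ^ 3) by ring.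
  rewrite -mulnA leq_mul2l popt //; apply: leq_trans tT _.
  by rewrite leq_exp2r.
have TE : T * energy G <= (8 + 4 * K) * t ^ 3.
  apply: leq_trans (leq_mul (leqnn T) En) _; rewrite mulnDr.
  have TT : T <= T ^ 2 by rewrite -mulnn leq_pmull //; lia.
  have : T * (t ^ 2 + T * t ^ 2) <= 8 * t ^ 3.
    have -> : T * (t ^ 2 + T * t ^ 2) = (T + T ^ 2) * t ^ 2 by ring.
    by have -> : 8 * t ^ 3 = (4 * t + 4 * t) * t ^ 2 by [ring];
      rewrite leq_mul2r leq_add ?orbT // (leq_trans TT).
  by move: TS; clear; rewrite mulnDl; lia.
have t0 : 0 < t by lia.
rewrite -(leq_pmul2l t0).
have -> : t * ((8 + 4 * K) ^ 2 * t ^ 5) = ((8 + 4 * K) * t ^ 3) ^ 2 by ring.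
apply: (@leq_trans ((T * energy G) ^ 2)); last by rewrite leq_exp2r.
by rewrite expnMn leq_mul2r tT orbT.
Qed.

(** * Exponential sums *)

Section Fourier.
Local Open Scope ring_scope.

(** For prime [p] the last clause also forces [psi] to be nontrivial. *)
Definition additive_character (p : nat) (psi : 'F_p -> algC) : Prop :=
  [/\ forall x y, psi (x + y) = psi x * psi y, forall x, psi (- x) = (psi x)^*
    & forall x, \sum_a psi (a * x) = if x == 0 then p%:R else 0].

Lemma additive_character_exists (p : nat) : prime p -> exists psi, @additive_character p psi.
Proof.
move=> pp; have [z zP] := C_prim_root_exists (prime_gt0 pp).
have zp : z ^+ (Zp_trunc (pdiv p)).+2 = 1 by rewrite Fp_cast // prim_expr_order.
pose psi (x : 'F_p) := z ^+ x.
have psiD x y : psi (x + y) = psi x * psi y by rewrite /psi /= expr_mod // exprD.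
have psi0 : psi 0 = 1 by [].
have psi1 : psi 1 = z by rewrite /psi /= modn_small.
have nz : `|z| = 1.
  apply/eqP; rewrite -(pexpr_eq1 (prime_gt0 pp) (normr_ge0 z)) -normrX.
  by rewrite (prim_expr_order zP) normr1.
have npsi x : `|psi x| = 1 by rewrite normrX nz expr1n.
exists psi; split=> // [x|x].
  have px0 : psi x != 0 by rewrite -normr_eq0 npsi oner_eq0.
  apply: (mulfI px0); rewrite -psiD subrr psi0 -normCK npsi expr1n //.
case: eqVneq => [->|x0].
  under eq_bigr => a _ do rewrite mulr0 psi0.
  by rewrite sumr_const card_Fp.
rewrite -(reindex_inj (h := fun a => a * x) (F := psi) (P := predT)) //=; last exact: mulIf.
(* Shifting the variable by 1 multiplies the full sum by [z], which differs from 1, so the sum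
   vanishes. *)
have eqS : \sum_a psi a = z * \sum_a psi a.
  rewrite [LHS](reindex_inj (addrI 1)) mulr_sumr; apply: eq_bigr => a _.
  by rewrite psiD psi1.
have z1 : z - 1 != 0.
  rewrite subr_eq0 -[z]expr1 -(prim_order_dvd zP) dvdn1.
  by apply/negP=> /eqP p1; rewrite p1 in pp.
by apply: (mulfI z1); rewrite mulr0 mulrBl mul1r -eqS subrr.
Qed.

(** Lagrange's identity: twice the difference of the two sides is a weighted sum of squares.
    Nonnegativity makes these squares of real numbers, as the order on [algC] requires. *)
Lemma weighted_cauchy (I : finType) (w x y : I -> algC) :
  (forall i, 0 <= w i) -> (forall i, 0 <= x i) -> (forall i, 0 <= y i) ->
  (\sum_i w i * x i * y i) ^+ 2 <= (\sum_i w i * x i ^+ 2) * \sum_i w i * y i ^+ 2.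
Proof.
move=> w0 x0 y0.
have : 0 <= \sum_i \sum_j w i * w j * (x i * y j - x j * y i) ^+ 2.
  apply: sumr_ge0 => i _; apply: sumr_ge0 => j _.
  apply: mulr_ge0; first exact: mulr_ge0.
  by rewrite real_exprn_even_ge0 // rpredB // rpredM ?ger0_real.
have -> : \sum_i \sum_j w i * w j * (x i * y j - x j * y i) ^+ 2 =
    ((\sum_i w i * x i ^+ 2) * (\sum_i w i * y i ^+ 2) - (\sum_i w i * x i * y i) ^+ 2) *+ 2.
  transitivity (\sum_i \sum_j ((w i * x i ^+ 2) * (w j * y j ^+ 2)
     + (w i * y i ^+ 2) * (w j * x j ^+ 2) + - (w i * x i * y i *+ 2) * (w j * x j * y j))).
    by apply: eq_bigr => i _; apply: eq_bigr => j _; ring.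
  under eq_bigr => i _ do rewrite 2!big_split /= -!mulr_sumr.
  by rewrite 2!big_split /= -!mulr_suml sumrN sumrMnl; ring.
by rewrite pmulrn_lge0 // subr_ge0.
Qed.

Variables (p : nat) (G : {set 'F_p}) (psi : 'F_p -> algC).
Hypotheses (p_prime : prime p) (subG : mult_subgroup G) (psiP : additive_character psi).

Let t := #|G|.

Lemma plancherel (f g : 'F_p -> algC) :
  \sum_a (\sum_v f v * psi (a * v)) * (\sum_v g v * psi (a * v))^* = p%:R * \sum_v f v * (g v)^*.
Proof.
case: psiP => psiD psiN psiS.
transitivity (\sum_a \sum_v \sum_w f v * (g w)^* * psi (a * (v - w))).
  apply: eq_bigr => a _; rewrite mulr_suml; apply: eq_bigr => v _.
  rewrite rmorph_sum mulr_sumr; apply: eq_bigr => w _.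
  by rewrite rmorphM /= -psiN mulrBr psiD; ring.
rewrite exchange_big mulr_sumr; apply: eq_bigr => v _.
rewrite exchange_big (bigD1 v) //= [X in _ + X]big1 => [|w wv].
  by rewrite addr0 -mulr_sumr psiS subrr eqxx mulrC.
by rewrite -mulr_sumr psiS subr_eq0 eq_sym (negPf wv) mulr0.
Qed.

Definition expsum (a : 'F_p) : algC := \sum_(r in G) psi (a * r).

(** Presents the dilated sum as the Fourier transform of the indicator of the coset [x G], the form
    required by [plancherel]. *)
Lemma expsumE a x : x != 0 -> expsum (a * x) = \sum_v (v / x \in G)%:R * psi (a * v).
Proof.
move=> x0; rewrite /expsum big_mkcond [RHS](reindex_inj (mulfI x0)) /=.
apply: eq_bigr => r _; rewrite [x * r / x]mulrAC divff // mul1r mulrA.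
by case: (r \in G); rewrite ?mul1r ?mul0r.
Qed.

Lemma expsum_indicator a : expsum a = \sum_v (v \in G)%:R * psi (a * v).
Proof.
rewrite -[a]mulr1 expsumE ?oner_eq0 // mulr1.
by apply: eq_bigr => v _; rewrite divr1.
Qed.

Lemma character0 : psi 0 = 1.
Proof.
case: psiP => psiD _ psiS; apply/eqP.
have : psi 0 * (psi 0 - 1) == 0 by rewrite mulrBr mulr1 -psiD addr0 subrr.
rewrite mulf_eq0 subr_eq0 => /orP [/eqP p0|//].
have := psiS 0; under eq_bigr => a _ do rewrite mulr0 p0.
by rewrite eqxx big1 // => /esym/eqP; rewrite pnatr_eq0 eqn0Ngt prime_gt0.
Qed.

Lemma expsum0 : expsum 0 = t%:R.
Proof.
rewrite /expsum; under eq_bigr => r _ do rewrite mul0r character0.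
by rewrite sumr_const.
Qed.

Lemma expsum_mulr a r : r \in G -> expsum (a * r) = expsum a.
Proof.
move=> rG; rewrite /expsum -(subgroup_sum_mulr subG (fun x => psi (a * x)) rG).
by apply: eq_bigr => x _; rewrite -mulrA [r * x]mulrC.
Qed.

(** The substitution [v = r - s] in the double sum. Applying [plancherel] to this transform turns
    the fourth moment into the energy. *)
Lemma expsum_normsq a : `|expsum a| ^+ 2 = \sum_v (diff_rep G v)%:R * psi (a * v).
Proof.
case: psiP => psiD psiN _; rewrite normCK.
transitivity (\sum_(r in G) \sum_v (r - v \in G)%:R * psi (a * v)).
  rewrite /expsum mulr_suml; apply: eq_bigr => r _.
  rewrite rmorph_sum mulr_sumr /= big_mkcond /=.
  rewrite [RHS](reindex_inj (inj_comp (addrI r) (@oppr_inj _))) /=; apply: eq_bigr => s _.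
  rewrite subKr mulrBr psiD -mulrN mulrN psiN.
  by case: (s \in G); rewrite ?mul1r ?mul0r.
rewrite exchange_big /=; apply: eq_bigr => v _; rewrite -mulr_suml; congr (_ * _).
rewrite /diff_rep -sum1_card natr_sum big_mkcond [RHS]big_mkcond; apply: eq_bigr => r _.
by rewrite inE; case: (r \in G); case: (r - v \in G).
Qed.

Lemma expsum_moment2 : \sum_a `|expsum a| ^+ 2 = (p * t)%:R.
Proof.
transitivity (\sum_a (\sum_v (v \in G)%:R * psi (a * v)) * (\sum_v (v \in G)%:R * psi (a * v))^*).
  by apply: eq_bigr => a _; rewrite normCK expsum_indicator.
rewrite plancherel natrM; congr (_ * _).
rewrite /t -sum1_card natr_sum [RHS]big_mkcond; apply: eq_bigr => v _.
by rewrite conjC_nat -natrM mulnb andbb; case: (v \in G).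
Qed.

Lemma expsum_moment4 : \sum_a `|expsum a| ^+ 4 = (p * energy G)%:R.
Proof.
transitivity (\sum_a (\sum_v (diff_rep G v)%:R * psi (a * v)) *
    (\sum_v (diff_rep G v)%:R * psi (a * v))^*).
  apply: eq_bigr => a _; rewrite -expsum_normsq (exprM _ 2 2) expr2; congr (_ * _).
  by rewrite rmorphXn /= conj_normC.
rewrite plancherel natrM natr_sum; congr (_ * _).
by apply: eq_bigr => v _; rewrite conjC_nat -natrM mulnn.
Qed.

(** The coset [a G] consists of [t] nonzero points at which [f] takes the same value. *)
Lemma orbit_sum_bound (f : 'F_p -> algC) a : (forall b, 0 <= f b) ->
  (forall b r, r \in G -> f (b * r) = f b) -> a != 0 -> t%:R * f a <= \sum_(b | b != 0) f b.
Proof.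
move=> f0 fG a0; have -> : t%:R * f a = \sum_(r in G) f (a * r).
  by under eq_bigr => r rG do rewrite fG //; rewrite sumr_const mulr_natl.
rewrite [X in _ <= X](reindex_inj (mulfI a0)) /=.
rewrite [X in X <= _]big_mkcond [X in _ <= X]big_mkcond; apply: ler_sum => r _.
case: ifP => [rG|_]; first by rewrite mulf_neq0 // (subgroup_neq0 subG).
by case: ifP.
Qed.

Lemma sum_neq0_le (f : 'F_p -> algC) : (forall b, 0 <= f b) ->
  \sum_(b | b != 0) f b <= \sum_b f b.
Proof. by move=> f0; rewrite [X in _ <= X](bigD1 0) //= lerDr. Qed.

Lemma sum_neq0_mulr (f : 'F_p -> algC) x : x != 0 ->
  \sum_(b | b != 0) f (b * x) = \sum_(b | b != 0) f b.
Proof.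
move=> x0; rewrite [RHS](reindex_inj (mulIf x0)) /=.
by apply: eq_bigl => b; rewrite mulf_eq0 (negPf x0) orbF.
Qed.

Let t_gt0 : 0 < t%:R :> algC.
Proof. by rewrite ltr0n (subgroup_card_gt0 subG). Qed.

Lemma expsum_sq_bound a : a != 0 -> `|expsum a| ^+ 2 <= p%:R.
Proof.
move=> a0; rewrite -(ler_pM2l t_gt0).
have := @orbit_sum_bound (fun a => `|expsum a| ^+ 2) a.
move/(_ (fun b => exprn_ge0 _ (normr_ge0 _))) => /=.
move/(_ (fun b r rG => congr1 (fun z => `|z| ^+ 2) (expsum_mulr b rG)) a0).
move/le_trans; apply; rewrite mulrC -natrM -expsum_moment2.
by apply: sum_neq0_le => b; rewrite exprn_ge0.
Qed.

Lemma expsum_pow4_bound a : a != 0 -> t%:R * `|expsum a| ^+ 4 <= (p * energy G)%:R.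
Proof.
move=> a0; have := @orbit_sum_bound (fun a => `|expsum a| ^+ 4) a.
move/(_ (fun b => exprn_ge0 _ (normr_ge0 _))) => /=.
move/(_ (fun b r rG => congr1 (fun z => `|z| ^+ 4) (expsum_mulr b rG)) a0).
move/le_trans; apply; rewrite -expsum_moment4.
by apply: sum_neq0_le => b; rewrite exprn_ge0.
Qed.

(** Averaging [|S|^2] over [a G] gives [t |S(a)|^2 <= sum r(v) |S(a v)|]. Cauchy-Schwarz with
    weights [r(v)], of total mass [t^2], gives [|S(a)|^4 <= sum r(v) |S(a v)|^2]; a second use
    separates the energy from the fourth moment. *)
Lemma expsum_pow8_bound a : a != 0 -> `|expsum a| ^+ 8 <= (p * energy G ^ 2)%:R.
Proof.
move=> a0; pose w v : algC := (diff_rep G v)%:R; pose y v := `|expsum (a * v)|.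
have w0 v : 0 <= w v by rewrite ler0n.
have y0 v : 0 <= y v by rewrite normr_ge0.
have wE : \sum_v w v = t%:R ^+ 2 by rewrite -natr_sum diff_rep_sum natrX.
have step1 : t%:R * `|expsum a| ^+ 2 <= \sum_v w v * y v.
  have tS : t%:R * `|expsum a| ^+ 2 = \sum_v w v * expsum (a * v).
    transitivity (\sum_(r in G) `|expsum (a * r)| ^+ 2).
      by under eq_bigr => r rG do rewrite expsum_mulr //; rewrite sumr_const mulr_natl.
    under eq_bigr => r _ do rewrite expsum_normsq.
    rewrite exchange_big /=; apply: eq_bigr => v _; rewrite /expsum mulr_sumr.
    by apply: eq_bigr => r _; rewrite mulrAC.
  rewrite -[X in X <= _]ger0_norm ?mulr_ge0 ?ler0n ?exprn_ge0 // tS.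
  apply: le_trans (ler_norm_sum _ _ _) _; apply: ler_sum => v _.
  by rewrite normrM ger0_norm.
have step2 : `|expsum a| ^+ 4 <= \sum_v w v * y v ^+ 2.
  have t2 : 0 < t%:R ^+ 2 :> algC by rewrite exprn_gt0.
  rewrite -(ler_pM2l t2) (exprM _ 2 2) -exprMn.
  apply: (@le_trans _ _ ((\sum_v w v * 1 * y v) ^+ 2)).
    rewrite ler_pXn2r ?nnegrE ?mulr_ge0 ?ler0n ?exprn_ge0 //.
      by under eq_bigr => v _ do rewrite mulr1.
    by apply: sumr_ge0 => v _; rewrite mulr1 mulr_ge0.
  apply: le_trans (weighted_cauchy _ _ _) _ => //.
  by under eq_bigr => v _ do rewrite expr1n mulr1; rewrite wE.
rewrite (exprM _ 4 2).
apply: (@le_trans _ _ ((\sum_v 1 * w v * y v ^+ 2) ^+ 2)).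
  rewrite ler_pXn2r ?nnegrE ?exprn_ge0 //.
    by under eq_bigr => v _ do rewrite mul1r.
  by apply: sumr_ge0 => v _; rewrite mul1r mulr_ge0 ?exprn_ge0.
apply: le_trans (weighted_cauchy _ _ _) _ => // [v|]; first exact: exprn_ge0.
have -> : \sum_v 1 * (y v ^+ 2) ^+ 2 = (p * energy G)%:R.
  rewrite -expsum_moment4 [RHS](reindex_inj (mulfI a0)).
  by apply: eq_bigr => v _; rewrite mul1r -exprM.
have -> : \sum_v 1 * w v ^+ 2 = (energy G)%:R.
  by rewrite natr_sum; apply: eq_bigr => v _; rewrite mul1r natrX.
by rewrite -natrM mulnCA mulnn.
Qed.

(** * Criteria for membership in the sumset *)

Lemma expsum_exp_expansion l : exists N : 'F_p -> algC,
  (forall a, expsum a ^+ l = \sum_y N y * psi (a * y)) /\ (forall y, y \notin sumset l G -> N y = 0).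
Proof.
case: psiP => psiD _ _; elim: l => [|l [N [NE N0]]].
  exists (fun y => (y == 0)%:R); split=> [a|y].
    rewrite (bigD1 0) //= ?eqxx mulr0 character0 mulr1 big1 ?addr0 // => y y0.
    by rewrite (negPf y0) mul0r.
  by rewrite inE => /negPf ->.
(* Convolution with the indicator of [G], so that [N y] counts the ordered representations of [y] as
   a sum of elements of [G]. *)
exists (fun y => \sum_(r in G) N (y - r)); split=> [a|y yS].
  rewrite exprSr NE /expsum mulr_sumr.
  under [RHS]eq_bigr => y _ do rewrite mulr_suml.
  rewrite [RHS]exchange_big /=; apply: eq_bigr => r rG.
  rewrite mulr_suml [RHS](reindex_inj (addIr r)) /=; apply: eq_bigr => y _.
  by rewrite addrK mulrDr psiD mulrA.
rewrite big1 // => r rG; apply: N0; apply: contra yS => yr.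
by apply/imset2P; exists (y - r) r => //; rewrite subrK.
Qed.

Lemma sumset_mulr l x r : r \in G -> x \in sumset l G -> x * r \in sumset l G.
Proof.
move=> rG; elim: l x => [|l IH] x /=; first by rewrite !inE => /eqP ->; rewrite mul0r.
case/imset2P=> y s yl sG ->; rewrite mulrDl; apply/imset2P.
by exists (y * r) (s * r); rewrite ?IH ?(subgroup_mulr subG).
Qed.

(** Since [lG] is stable under [G], a missing [x] makes all of [x G] miss it. By [plancherel] the
    full sum of [S(a)^l] times the conjugate of [S(a x)] is then 0, while its term at [a = 0] is
    [t^(l+1)]. *)
Lemma missing_sum_lower_bound l x : x != 0 -> x \notin sumset l G ->
  t%:R ^+ l.+1 <= \sum_(a | a != 0) `|expsum a| ^+ l * `|expsum (a * x)|.
Proof.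
move=> x0 xS; have [N [NE N0]] := expsum_exp_expansion l.
have total0 : \sum_a expsum a ^+ l * (expsum (a * x))^* = 0.
  under eq_bigr => a _ do rewrite NE expsumE //.
  rewrite plancherel big1 ?mulr0 // => v _.
  have [vxG|_] := boolP (v / x \in G); last by rewrite conjC0 mulr0.
  rewrite N0 ?mul0r //; apply: contra xS => vS.
  have vx0 := subgroup_neq0 subG vxG.
  have -> : x = v * (v / x)^-1.
    by rewrite invf_div mulrCA divff ?mulr1 //; apply: contraNneq vx0 => ->; rewrite mul0r.
  by apply: sumset_mulr vS; case: subG => _ _ _; apply.
move: total0; rewrite (bigD1 0) //= mul0r expsum0 conjC_nat -exprSr => /eqP.
rewrite addr_eq0 => /eqP tE.
have tn : `|t%:R ^+ l.+1| = t%:R ^+ l.+1 :> algC by rewrite ger0_norm // exprn_ge0 // ler0n.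
rewrite -[X in X <= _]tn tE normrN; apply: le_trans (ler_norm_sum _ _ _) _.
by apply: ler_sum => a _; rewrite normrM normrX norm_conjC.
Qed.

(** From [2 u v <= u^2 + v^2], since dilation by [x] permutes the nonzero frequencies. *)
Lemma sum_mul_rotate_le x : x != 0 ->
  \sum_(a | a != 0) `|expsum a| * `|expsum (a * x)| <= (p * t)%:R.
Proof.
move=> x0; apply: (@le_trans _ _ (\sum_(a | a != 0) `|expsum a| ^+ 2)); last first.
  by rewrite -expsum_moment2 sum_neq0_le // => b; rewrite exprn_ge0.
rewrite -(ler_pMn2r (n := 2)) //.
apply: (@le_trans _ _ (\sum_(a | a != 0) (`|expsum a| ^+ 2 + `|expsum (a * x)| ^+ 2))).
  rewrite -sumrMnl; apply: ler_sum => a _.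
  have : 0 <= (`|expsum a| - `|expsum (a * x)|) ^+ 2.
    by rewrite real_exprn_even_ge0 // rpredB ?normr_real.
  by rewrite sqrrB addrAC subr_ge0.
by rewrite big_split /= (sum_neq0_mulr (fun b => `|expsum b| ^+ 2) x0) mulr2n.
Qed.

(** Weighted arithmetic-geometric mean inequality, by an explicit factorisation; it brings the mixed
    sum below down to the fourth moment. *)
Lemma cube_mul_le (u v : algC) : 0 <= u -> 0 <= v -> u ^+ 3 * v *+ 4 <= u ^+ 4 *+ 3 + v ^+ 4.
Proof.
move=> u0 v0; rewrite -subr_ge0.
have -> : u ^+ 4 *+ 3 + v ^+ 4 - u ^+ 3 * v *+ 4 = (u - v) ^+ 2 * ((u + v) ^+ 2 + u ^+ 2 *+ 2) by ring.
apply: mulr_ge0; first by rewrite real_exprn_even_ge0 // rpredB ?ger0_real.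
by rewrite addr_ge0 ?mulrn_wge0 ?exprn_ge0 ?addr_ge0.
Qed.

Lemma sum_cube_mul_rotate_le x : x != 0 ->
  \sum_(a | a != 0) `|expsum a| ^+ 3 * `|expsum (a * x)| <= (p * energy G)%:R.
Proof.
move=> x0; apply: (@le_trans _ _ (\sum_(a | a != 0) `|expsum a| ^+ 4)); last first.
  by rewrite -expsum_moment4 sum_neq0_le // => b; rewrite exprn_ge0.
rewrite -(ler_pMn2r (n := 4)) //.
apply: (@le_trans _ _ (\sum_(a | a != 0) (`|expsum a| ^+ 4 *+ 3 + `|expsum (a * x)| ^+ 4))).
  by rewrite -sumrMnl; apply: ler_sum => a _; apply: cube_mul_le.
by rewrite big_split /= (sum_neq0_mulr (fun b => `|expsum b| ^+ 4) x0) sumrMnl -mulrSr.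
Qed.

(** The bound [B] is spent on [k] factors and the other [m] are kept for a moment: [m = 1] with the
    second, [m = 3] with the fourth. *)
Lemma sum_bound_split (B M : algC) (k m : nat) x : 0 <= B -> (forall a, a != 0 -> `|expsum a| <= B) ->
  \sum_(a | a != 0) `|expsum a| ^+ m * `|expsum (a * x)| <= M ->
  \sum_(a | a != 0) `|expsum a| ^+ (k + m) * `|expsum (a * x)| <= B ^+ k * M.
Proof.
move=> B0 SB SM.
apply: (@le_trans _ _ (B ^+ k * \sum_(a | a != 0) `|expsum a| ^+ m * `|expsum (a * x)|)); last first.
  by rewrite ler_wpM2l ?exprn_ge0.
rewrite mulr_sumr; apply: ler_sum => a a0; rewrite exprD -mulrA ler_wpM2r ?mulr_ge0 ?exprn_ge0 //.
by rewrite lerXn2r ?nnegrE // SB.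
Qed.

(** With [B = sqrt p] and [k = l - 1], a missing [x] would give [t^(l+1) <= p^((l-1)/2) p t]. *)
Lemma sumset_criterion_sqrt l x : (0 < l)%N -> (p ^ l.+1 < t ^ (2 * l))%N -> x != 0 -> x \in sumset l G.
Proof.
move=> l0 ptl x0; apply: contraLR ptl => xS; rewrite -leqNgt.
have := missing_sum_lower_bound x0 xS.
have [k lE] : exists k, l = (k + 1)%N by exists l.-1; lia.
set B := sqrtC p%:R : algC.
have B0 : 0 <= B by rewrite sqrtC_ge0 ler0n.
have SB a : a != 0 -> `|expsum a| <= B.
  move=> a0; rewrite -(@ler_pXn2r _ 2) ?nnegrE // sqrtCK; exact: expsum_sq_bound.
have := @sum_bound_split B (p * t)%:R k 1 x B0 SB.
rewrite -lE => /(_ (sum_mul_rotate_le x0)) h1 /le_trans /(_ h1) h2.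
have : (t%:R ^+ l.+1) ^+ 2 <= (B ^+ k * (p * t)%:R) ^+ 2.
  by rewrite lerXn2r ?nnegrE ?mulr_ge0 ?exprn_ge0 ?ler0n.
rewrite [(B ^+ k * _) ^+ 2]exprMn [(B ^+ k) ^+ 2]exprAC sqrtCK -!natrX -!natrM ler_nat => h3.
have t0 : (0 < t ^ 2)%N by rewrite expn_gt0 (subgroup_card_gt0 subG).
rewrite -(leq_pmul2r t0) -expnD.
have -> : (t ^ (2 * l + 2) = (t ^ l.+1) ^ 2)%N by rewrite -expnM; congr (_ ^ _)%N; lia.
suff -> : (p ^ l.+1 * t ^ 2 = p ^ k * (p * t) ^ 2)%N by [].
by rewrite lE expnMn mulnA -expnD; congr (_ ^ _ * _)%N; lia.
Qed.

(** With [B^4 = p E / t] and [k = l - 3], a missing [x] would give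
    [t^(4 l + 4) <= (p E / t)^(l-3) (p E)^4]. *)
Lemma sumset_criterion_energy4 l x : (3 <= l)%N ->
  ((p * energy G) ^ l.+1 < t ^ (5 * l + 1))%N -> x != 0 -> x \in sumset l G.
Proof.
move=> l3 ptl x0; apply: contraLR ptl => xS; rewrite -leqNgt.
have := missing_sum_lower_bound x0 xS.
have [k lE] : exists k, l = (k + 3)%N by exists (l - 3)%N; lia.
pose B : algC := 4.-root ((p * energy G)%:R / t%:R).
have B0 : 0 <= B by rewrite rootC_ge0 // divr_ge0 ?ler0n.
have BK : B ^+ 4 = (p * energy G)%:R / t%:R by rewrite rootCK.
have SB a : a != 0 -> `|expsum a| <= B.
  move=> a0; rewrite -(@ler_pXn2r _ 4) ?nnegrE // BK ler_pdivlMr // mulrC.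
  exact: expsum_pow4_bound.
have := @sum_bound_split B (p * energy G)%:R k 3 x B0 SB.
rewrite -lE => /(_ (sum_cube_mul_rotate_le x0)) h1 /le_trans /(_ h1) h2.
have : (t%:R ^+ l.+1) ^+ 4 <= (B ^+ k * (p * energy G)%:R) ^+ 4.
  by rewrite lerXn2r ?nnegrE ?mulr_ge0 ?exprn_ge0 ?ler0n.
rewrite [(B ^+ k * _) ^+ 4]exprMn [(B ^+ k) ^+ 4]exprAC BK.
rewrite expr_div_n mulrAC ler_pdivlMr ?exprn_gt0 // -!natrX -!natrM ler_nat.
rewrite -expnM -!expnD; move: lE; clear => lE.
by have [-> ->] : (l.+1 * 4 + k = 5 * l + 1 /\ k + 4 = l.+1)%N by lia.
Qed.

(** With [B^8 = p E^2] and [k = l - 3], a missing [x] would give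
    [t^(8 l + 8) <= (p E^2)^(l-3) (p E)^8]. *)
Lemma sumset_criterion_energy8 l x : (3 <= l)%N ->
  (p ^ (l + 5) * (energy G ^ 2) ^ l.+1 < t ^ (8 * l.+1))%N -> x != 0 -> x \in sumset l G.
Proof.
move=> l3 ptl x0; apply: contraLR ptl => xS; rewrite -leqNgt.
have := missing_sum_lower_bound x0 xS.
have [k lE] : exists k, l = (k + 3)%N by exists (l - 3)%N; lia.
pose B : algC := 8.-root (p * energy G ^ 2)%:R.
have B0 : 0 <= B by rewrite rootC_ge0 // ler0n.
have BK : B ^+ 8 = (p * energy G ^ 2)%:R by rewrite rootCK.
have SB a : a != 0 -> `|expsum a| <= B.
  by move=> a0; rewrite -(@ler_pXn2r _ 8) ?nnegrE // BK; apply: expsum_pow8_bound.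
have := @sum_bound_split B (p * energy G)%:R k 3 x B0 SB.
rewrite -lE => /(_ (sum_cube_mul_rotate_le x0)) h1 /le_trans /(_ h1) h2.
have : (t%:R ^+ l.+1) ^+ 8 <= (B ^+ k * (p * energy G)%:R) ^+ 8.
  by rewrite lerXn2r ?nnegrE ?mulr_ge0 ?exprn_ge0 ?ler0n.
rewrite [(B ^+ k * _) ^+ 8]exprMn [(B ^+ k) ^+ 8]exprAC BK -!natrX -!natrM ler_nat.
rewrite -expnM mulnC => h3; apply: leq_trans h3 _.
suff -> : ((p * energy G ^ 2) ^ k * (p * energy G) ^ 8
   = p ^ (l + 5) * (energy G ^ 2) ^ l.+1)%N by [].
rewrite lE; move: (energy G) => E; rewrite (expnMn p (E ^ 2)) (expnMn p E) mulnACA -expnD -!expnM -expnD.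
by congr (_ ^ _ * _ ^ _)%N; lia.
Qed.

End Fourier.

(** * Conclusion *)

Section Conclusion.
Variables (p : nat) (G : {set 'F_p}) (l : nat) (x : 'F_p).
Hypotheses (p_prime : prime p) (subG : mult_subgroup G) (x_neq0 : x != GRing.zero).
Let t := #|G|.

Lemma sumset_large : 0 < l -> p ^ l.+1 < t ^ (2 * l) -> x \in sumset l G.
Proof.
have [psi psiP] := additive_character_exists p_prime.
move=> l0 ptl; exact: (sumset_criterion_sqrt p_prime subG psiP).
Qed.

Variables K c : nat.
Hypothesis energyK : energy G ^ 2 <= K * t ^ 5.
Hypothesis ltKc : K < c.

Let t_gt0 : 0 < t. Proof. exact: subgroup_card_gt0 subG. Qed.

Let Kc n m : n < m -> K ^ n.+1 < c ^ m.
Proof.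
move=> nm; apply: (@leq_trans (c ^ n.+1)); first by rewrite ltn_exp2r.
by rewrite leq_pexp2l // (leq_ltn_trans _ ltKc).
Qed.

(** In [8 (l+1) = (3 l + 3) + 5 (l+1)] the last summand is consumed by the power [l + 1] of
    [E^2 <= K t^5]; the power of [c] absorbs [K^(l+1)]. *)
Lemma sumset_energy8 :
  3 <= l -> c ^ (3 * l + 3) * p ^ (l + 5) <= t ^ (3 * l + 3) -> x \in sumset l G.
Proof.
move=> l3 ct; have [psi psiP] := additive_character_exists p_prime.
apply: (sumset_criterion_energy8 p_prime subG psiP) => //; rewrite -/t.
have -> : 8 * l.+1 = (3 * l + 3) + 5 * l.+1 by lia.
rewrite (expnD t); apply: (@leq_ltn_trans (p ^ (l + 5) * K ^ l.+1 * t ^ (5 * l.+1))).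
  by rewrite -mulnA leq_mul2l (expnM t) -expnMn leq_exp2r // energyK orbT.
rewrite ltn_pmul2r ?expn_gt0 ?t_gt0 //; apply: leq_trans ct.
by rewrite mulnC ltn_pmul2r ?expn_gt0 ?prime_gt0 // Kc //; lia.
Qed.

(** The criterion is squared so that [E] enters through [E^2]; then
    [2 (5 l + 1) = (5 l - 3) + 5 (l+1)] splits the exponent of [t]. *)
Lemma sumset_energy4 :
  3 <= l -> c ^ (5 * l - 3) * p ^ (2 * l + 2) <= t ^ (5 * l - 3) -> x \in sumset l G.
Proof.
move=> l3 ct; have [psi psiP] := additive_character_exists p_prime.
apply: (sumset_criterion_energy4 p_prime subG psiP) => //; rewrite -/t.
rewrite -(@ltn_exp2r _ _ 2) // -!expnM.
have -> : (5 * l + 1) * 2 = (5 * l - 3) + 5 * l.+1 by lia.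
rewrite (expnD t) [l.+1 * 2]mulnC expnMn (expnM (energy G)).
apply: (@leq_ltn_trans (p ^ (2 * l + 2) * K ^ l.+1 * t ^ (5 * l.+1))).
  rewrite -mulnA (_ : 2 * l.+1 = 2 * l + 2); last by lia.
  by rewrite leq_mul2l (expnM t) -expnMn leq_exp2r // energyK orbT.
rewrite ltn_pmul2r ?expn_gt0 ?t_gt0 //; apply: leq_trans ct.
by rewrite mulnC ltn_pmul2r ?expn_gt0 ?prime_gt0 // Kc //; lia.
Qed.

End Conclusion.

(** Two regimes: if [t^8 > p^5], then [sumset_large] applies because [4 (l+1) <= 5 l] for [l >= 4];
    otherwise [t] is small enough for [energy_bound]. *)
Lemma sumset_covers : exists c : nat, 0 < c /\
  forall (p : nat) (G : {set 'F_p}) (l : nat) (x : 'F_p),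
  prime p -> mult_subgroup G -> x != GRing.zero -> 4 <= l ->
  c ^ (5 * l - 3) * p ^ (2 * l + 2) <= #|G| ^ (5 * l - 3) \/
  c ^ (3 * l + 3) * p ^ (l + 5) <= #|G| ^ (3 * l + 3) -> x \in sumset l G.
Proof.
have [K energyK] := energy_bound.
(* Here [K < c] absorbs the energy constant, [8 < c] provides [8 < t], and [16^5 <= c <= t] gives
   [16^5 t^15 <= t^16 <= p^10], that is [16 t^3 <= p^2]. *)
have [c [dc c8 Kc]] : exists c, [/\ 16 ^ 5 <= c, 8 < c & K < c].
  by exists (16 ^ 5 + (K + 9)); rewrite leq_addr; split=> //; lia.
exists c; split=> [|p G l x pp sG x0 l4 ct]; first by lia.
have [tp|tp] := ltnP (p ^ 5) (#|G| ^ 8).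
  apply: sumset_large => //; first by lia.
  rewrite -(@ltn_exp2r _ _ 4) // -!expnM.
  apply: (@leq_ltn_trans (p ^ (5 * l))).
    by rewrite leq_pexp2l ?prime_gt0 //; lia.
  rewrite (_ : 2 * l * 4 = 8 * l); last by lia.
  by rewrite !(expnM _ _ l) ltn_exp2r //; lia.
have ct0 : c <= #|G|.
  have pow_le m n : 0 < m -> c ^ m * p ^ n <= #|G| ^ m -> c <= #|G|.
    move=> m0 h; rewrite -(leq_exp2r _ _ m0); apply: leq_trans h.
    by rewrite leq_pmulr // expn_gt0 prime_gt0.
  by case: ct => /pow_le; apply; lia.
have {}energyK : energy G ^ 2 <= K * #|G| ^ 5.
  apply: energyK => //; first exact: leq_trans ct0.
  rewrite -(@leq_exp2r _ _ 5) // -expnM (expnM p 5 2).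
  apply: (@leq_trans ((#|G| ^ 8) ^ 2)); last by rewrite leq_exp2r.
  rewrite expnMn -!expnM (expnD _ 1 15) leq_mul2r expn1.
  by rewrite (leq_trans dc ct0) orbT.
have l3 : 2 < l by lia.
case: ct => ct; [exact: sumset_energy4 energyK Kc l3 ct|exact: sumset_energy8 energyK Kc l3 ct].
Qed.

(* From real exponents to inequalities between integer powers *)
From Stdlib Require Import Reals.

Lemma INR_expn (m n : nat) : INR (expn m n) = (INR m ^ n)%R.
Proof. by elim: n => [|n IH]; rewrite ?expn0 // expnS mult_INR IH. Qed.

Lemma Rpower_quotient_pow (q : R) (a b : nat) : (0 < q)%R -> 0 < b ->
  (Rpower q (INR a / INR b) ^ b = q ^ a)%R.
Proof.
move=> q0 b0; rewrite -Rpower_pow; last exact: exp_pos.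
rewrite Rpower_mult -Rpower_pow //; congr Rpower; field.
by apply: not_0_INR => b00; rewrite b00 in b0.
Qed.

Lemma pow_lt_strict (u v : R) (n : nat) : (0 <= u)%R -> (u < v)%R -> 0 < n -> (u ^ n < v ^ n)%R.
Proof.
case: n => // n u0 uv _; elim: n => [|n IH]; first by rewrite !pow_1.
by apply: Rmult_le_0_lt_compat => //; exact: (pow_le u n.+1).
Qed.

Lemma nat_of_Rpower_le (p t c a b : nat) : 0 < p -> 0 < b ->
  (INR c * Rpower (INR p) (INR a / INR b) <= INR t)%R -> expn c b * expn p a <= expn t b.
Proof.
move=> p0 b0 h; have p0' : (0 < INR p)%R by apply: lt_0_INR; lia.
apply/ssrnat.leP/INR_le; rewrite mult_INR !INR_expn -(Rpower_quotient_pow a p0' b0) -Rpow_mult_distr.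
apply: pow_incr; split=> //; apply: Rmult_le_pos; first exact: pos_INR.
exact/Rlt_le/exp_pos.
Qed.

Lemma nat_of_Rpower_lt (p t a b : nat) : 0 < p -> 0 < b ->
  (Rpower (INR p) (INR a / INR b) < INR t)%R -> expn p a < expn t b.
Proof.
move=> p0 b0 h; have p0' : (0 < INR p)%R by apply: lt_0_INR; lia.
apply/ssrnat.ltP/INR_lt; rewrite !INR_expn -(Rpower_quotient_pow a p0' b0).
by apply: pow_lt_strict => //; apply/Rlt_le/exp_pos.
Qed.

Theorem theorem2p6 :
  (exists C : R, (0 < C)%R /\
     forall (p : nat), prime p ->
     forall (A : {set 'F_p}), mult_subgroup A ->
     forall l : nat, (4 <= l)%N ->
     (INR #|A| >= C * Rmin (Rpower (INR p) ((2 * INR l + 2) / (5 * INR l - 3)))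
                           (Rpower (INR p) ((INR l + 5) / (3 * INR l + 3))))%R ->
     forall x : 'F_p, x != (GRing.zero : 'F_p) -> x \in sumset l A)
  /\
  (forall (p : nat), prime p ->
   forall (A : {set 'F_p}), mult_subgroup A ->
   forall l : nat, (2 <= l)%N ->
   (INR #|A| > Rpower (INR p) ((INR l + 1) / (2 * INR l)))%R ->
   forall x : 'F_p, x != (GRing.zero : 'F_p) -> x \in sumset l A).
Proof.
have INR2 : (INR 2 = 2)%R by [].
have INR3 : (INR 3 = 3)%R by rewrite INR_IZR_INZ.
have INR5 : (INR 5 = 5)%R by rewrite INR_IZR_INZ.
split.
  have [c [c0 covers]] := sumset_covers.
  exists (INR c); split=> [|p pp A sA l l4 /Rge_le hA x x0]; first by apply: lt_0_INR; lia.
  apply: covers => //; move: hA.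
  (* The natural subtraction [5 * l - 3] does not truncate, as [l >= 4]. *)
  have -> : ((2 * INR l + 2) / (5 * INR l - 3) = INR (2 * l + 2) / INR (5 * l - 3))%R.
    rewrite plus_INR minus_INR ?mult_INR; last by apply/ssrnat.leP; lia.
    by rewrite INR2 INR3 INR5.
  have -> : ((INR l + 5) / (3 * INR l + 3) = INR (l + 5) / INR (3 * l + 3))%R.
    by rewrite (plus_INR l) (plus_INR (3 * l)) mult_INR INR3 INR5.
  have p0 := prime_gt0 pp.
  by rewrite /Rmin; case: Rle_dec => _ hA; [left|right]; apply: nat_of_Rpower_le hA => //; lia.
move=> p pp A sA l l2 /Rgt_lt hA x x0.
apply: sumset_large => //; first by lia.
apply: nat_of_Rpower_lt; [exact: prime_gt0 | by lia |].
by rewrite S_INR mult_INR INR2.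
Qed.
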